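(* There exist partitions $\lambda,\mu,\nu$ such that the function ${\mathfrak N}_{\mu,\nu,\lambda}:{\mathbb Z}_{\ge1}\to{\mathbb Z}_{\geq 0}$, $k\mapsto N_{k\mu,k\nu,k\lambda}$, is not given by a polynomial in ${\mathbb R}[k]$; that is, there is no $f\in{\mathbb R}[k]$ with $f(k)=N_{k\mu,k\nu,k\lambda}$ for all integers $k\ge1$.
   Context: For a partition $\lambda=(\lambda_1,\lambda_2,\ldots)$, $k\lambda=(k\lambda_1,k\lambda_2,\ldots)$. With $c_{\alpha,\beta}^{\mu}$ the Littlewood-Richardson coefficient ($s_\alpha s_\beta=\sum_\mu c_{\alpha,\beta}^\mu s_\mu$), the Newell-Littlewood number is $$N_{\mu,\nu,\lambda}=\sum_{\alpha,\beta,\gamma} c_{\alpha,\beta}^{\mu}c_{\alpha,\gamma}^{\nu}c_{\beta,\gamma}^{\lambda},$$ the sum over all triples of partitions (finitely many nonzero terms). *)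

(* Defs.v *)
From HB Require Import structures.
From mathcomp Require Import all_boot all_order all_algebra.
From mathcomp Require Import finmap.
From mathcomp Require Import mpoly.
From mathcomp Require Import boolp classical_sets fsbigop reals.

Set Implicit Arguments.
Unset Strict Implicit.
Unset Printing Implicit Defensive.

Import GRing.Theory.

Local Open Scope ring_scope.

(* Partitions are represented by their nonzero parts, in weakly decreasing
   order, so that Leibniz equality is equality of partitions. *)
Definition is_part (s : seq nat) : bool := sorted geq s && (0%N \notin s).

Record part : Type := Part { parts :> seq nat; partsP : is_part parts }.

HB.instance Definition _ := [isSub for parts].
HB.instance Definition _ := [Countable of part by <:].

Lemma scale_part_subproof (k : nat) (la : part) :
  is_part [seq i <- [seq (k * j)%N | j <- la] | i != 0%N].
Proof.
have /andP[la_sorted _] := partsP la; apply/andP; split; last first.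
  by rewrite mem_filter eqxx.
apply: sorted_filter; first by move=> y x z xy yz; apply: leq_trans yz xy.
by apply: homo_sorted la_sorted => x y xy; rewrite /= leq_mul2l (xy : (y <= x)%N) orbT.
Qed.

(* The filter is the identity for [k >= 1]; for [k = 0] it yields the empty
   partition. *)
Definition scale_part (k : nat) (la : part) : part :=
  Part (scale_part_subproof k la).

Definition cell (la : part) : finType :=
  {i : 'I_(size la) & 'I_(nth 0%N la i)}.

Definition cell_row (la : part) (c : cell la) : nat := tag c.
Definition cell_col (la : part) (c : cell la) : nat := tagged c.

Definition semistandard (n : nat) (la : part) (T : {ffun cell la -> 'I_n}) :
    bool :=
  [forall c, forall d,
    ((cell_row c == cell_row d) && (cell_col c < cell_col d)%N ==>
       (T c <= T d)%N) &&
    ((cell_col c == cell_col d) && (cell_row c < cell_row d)%N ==>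
       (T c < T d)%N)].

(* The Schur polynomial s_la(x_0, ..., x_(n-1)); the Schur function s_la is
   the compatible family of these polynomials for all n. *)
Definition schur (n : nat) (la : part) : {mpoly int[n]} :=
  \sum_(T : {ffun cell la -> 'I_n} | semistandard T)
    \prod_(c : cell la) 'X_(T c).

(* The identity s_al s_be = sum_mu (f mu) s_mu between symmetric functions,
   i.e. in every number of variables. *)
Definition schur_expansion (al be : part)
    (f : {fsfun part -> nat with 0%N}) : Prop :=
  forall n : nat,
    schur n al * schur n be = \sum_(mu <- finsupp f) schur n mu *+ f mu.

(* [xget] selects the (classically, existing and unique) family of
   coefficients of the Schur expansion of s_al s_be; they are nonnegative
   integers, and the default value (the zero family) is never needed. *)
Definition lr_expansion (al be : part) : {fsfun part -> nat with 0%N} :=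
  xget [fsfun] [set f | schur_expansion al be f]%classic.

Definition lr_coef (al be mu : part) : nat := lr_expansion al be mu.

(* [\big[_/_]_(_ \in _)] is the sum over the support, which is finite here. *)
Definition newell_littlewood (mu nu la : part) : nat :=
  \big[addn/0%N]_(t \in [set: part * part * part]%classic)
    (lr_coef t.1.1 t.1.2 mu * lr_coef t.1.1 t.2 nu * lr_coef t.1.2 t.2 la)%N.

(* Main.v *)
Require Import Defs.
From mathcomp Require Import all_boot all_order all_algebra.
From mathcomp Require Import reals.
From mathcomp Require Import finmap mpoly boolp classical_sets fsbigop.
From mathcomp Require Import zify.

(** The witness is la = mu = nu = (1), for which N_{(k),(k),(k)} is 0 for odd k
    and nonzero for k = 2.

    A nonzero Littlewood-Richardson coefficient c_{al,be}^{mu} forces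
    |mu| = |al| + |be| ([lr_coef_graded]), so a nonzero term of the
    Newell-Littlewood sum gives |mu| + |nu| + |la| = 2 (|al| + |be| + |ga|).
    Hence N_{mu,nu,la} vanishes when |mu| + |nu| + |la| is odd
    ([newell_littlewood_odd]), in particular on the k-th multiples of (1) for
    odd k, and a polynomial interpolating these values has infinitely many
    roots, so it is zero ([poly_odd_roots_eq0]). For k = 2 the same degree
    count leaves only al = be = ga = (1), and this term is nonzero because
    c_{(1),(1)}^{(2)} is ([lr_coef_row1_row2], [newell_littlewood_row2]).

    No uniqueness of Schur expansions is needed: substituting one variable 'X
    for all the x_i turns s_la(x_0, ..., x_(n-1)) into K 'X^|la|, where K counts
    the semistandard tableaux of shape la with entries below n
    ([schur_diagonal]). Since the expansion coefficients and the K are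
    natural numbers, no cancellation can occur, and comparing coefficients
    ([schur_expansion_graded]) for a well-chosen n controls every expansion. *)

Set Implicit Arguments.
Unset Strict Implicit.
Unset Printing Implicit Defensive.

Import GRing.Theory Num.Theory.

Local Open Scope ring_scope.

(** * Schur polynomials on the diagonal *)

(** The number of semistandard tableaux of shape [la] with entries in
    {0, ..., n-1}. *)
Definition ssyt_count (n : nat) (la : part) : nat :=
  #|[pred T : {ffun cell la -> 'I_n} | semistandard T]|.

Lemma card_cell (la : part) : #|cell la| = sumn la.
Proof.
rewrite card_tagged sumnE big_map big_enum /=.
rewrite [RHS]sumnE (big_nth 0%N) big_mkord.
by apply: eq_bigr => i _; rewrite card_ord.
Qed.

Lemma schur_diagonal (n : nat) (la : part) :
  mmap polyC (fun _ => 'X) (schur n la) = 'X^(sumn la) *+ ssyt_count n la.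
Proof.
rewrite /schur raddf_sum /= (eq_bigr (fun=> 'X^(sumn la))).
  by rewrite sumr_const.
move=> T _; rewrite rmorph_prod /= -card_cell -prodr_const.
by apply: eq_bigr => c _; rewrite mmapX mmap1U.
Qed.

(** The coefficient of ['X^d] in a Schur expansion evaluated on the diagonal.
    All the terms are natural numbers. *)
Lemma schur_expansion_graded (al be : part)
    (f : {fsfun part -> nat with 0%N}) (n d : nat) :
    schur_expansion al be f ->
  ((d == sumn al + sumn be) * (ssyt_count n al * ssyt_count n be) =
   \sum_(mu <- finsupp f) (d == sumn mu) * (ssyt_count n mu * f mu))%N.
Proof.
move=> /(_ n)/(congr1 (mmap polyC (fun _ => 'X)))/(congr1 (fun p : {poly int} => p`_d)).
rewrite rmorphM /= !schur_diagonal raddf_sum /= coef_sum.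
rewrite mulrnAl mulrnAr -exprD !coefMn coefXn -!mulrnA => e.
apply/eqP; rewrite -(eqr_nat int) natr_sum (mulnC (ssyt_count n al)) e.
apply/eqP; apply: eq_bigr => mu _.
by rewrite mmapMn schur_diagonal !coefMn coefXn natrM mulr_natr mulrnA.
Qed.

(** Filling each cell with its row index gives a semistandard tableau. *)
Lemma ssyt_count_gt0 (la : part) : (0 < ssyt_count (size la) la)%N.
Proof.
apply/card_gt0P; exists [ffun c => tag c]; rewrite inE.
apply/forallP => c; apply/forallP => d; rewrite !ffunE.
by apply/andP; split; apply/implyP => /andP[]// /eqP; rewrite /cell_row => ->.
Qed.

Lemma part_nth_gt0 (la : part) (i : nat) :
  (i < size la)%N -> (0 < nth 0%N la i)%N.
Proof.
move=> lti; rewrite lt0n; apply: contraTneq (mem_nth 0%N lti) => ->.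
by have /andP[] := partsP la.
Qed.

(** With a single letter, columns cannot increase strictly. *)
Lemma ssyt_count1_gt0 (la : part) : (0 < ssyt_count 1 la -> size la <= 1)%N.
Proof.
move=> /card_gt0P[T]; rewrite inE => ssT; rewrite leqNgt; apply/negP => la_gt1.
have la_gt0 := ltnW la_gt1.
pose c i (lti : (i < size la)%N) : cell la :=
  existT _ (Ordinal lti) (Ordinal (part_nth_gt0 lti)).
have := forallP (forallP ssT (c _ la_gt0)) (c _ la_gt1).
by rewrite /cell_row /cell_col /= !ord1.
Qed.

(** * Littlewood-Richardson coefficients *)

Lemma lr_coef_graded (al be mu : part) :
  lr_coef al be mu != 0%N -> (sumn mu = sumn al + sumn be)%N.
Proof.
rewrite /lr_coef /lr_expansion.
case: xgetP => [f _ /= exp_f fmu_neq0 | _]; last by rewrite fsfun0E.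
(* With [size mu] variables the term of [mu] in degree |mu| is positive. *)
have := schur_expansion_graded (size mu) (sumn mu) exp_f.
rewrite (big_fsetD1 mu) ?mem_finsupp //= eqxx mul1n.
case: eqP => // _ /eqP.
by rewrite mul0n eq_sym addn_eq0 muln_eq0 (negPf fmu_neq0) orbF -leqn0 leqNgt
           ssyt_count_gt0.
Qed.

(** The partitions (1), (2) and (1,1). *)
Definition row1 : part := @Part [:: 1%N] isT.
Definition row2 : part := @Part [:: 2%N] isT.
Definition col2 : part := @Part [:: 1%N; 1%N] isT.

Lemma part_sumn1 (la : part) : sumn la = 1%N -> la = row1.
Proof.
move=> la1; apply: val_inj => /=.
have := @part_nth_gt0 la 1; have := @part_nth_gt0 la 0.
by case: (parts la) la1 => [|[|[|x]] [|[|y] s]] //= _ // /(_ isT) // _ /(_ isT).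
Qed.

Lemma part_row2 (la : part) : sumn la = 2%N -> (size la <= 1)%N -> la = row2.
Proof.
move=> la2 size_la; apply: val_inj => /=.
by case: (parts la) la2 size_la => [|x []] //=; rewrite addn0 => ->.
Qed.

(** For a shape with two cells, enumerated by [g : bool -> cell la], fillings are
    pairs of letters. *)
Lemma schur_two_cells (n : nat) (la : part) (g : bool -> cell la)
    (g' : cell la -> bool) (T := fun p : 'I_n * 'I_n =>
      [ffun c => if g' c then p.2 else p.1] : {ffun cell la -> 'I_n}) :
    cancel g g' -> cancel g' g ->
  schur n la = \sum_(p | semistandard (T p)) 'X_(p.1) * 'X_(p.2).
Proof.
move=> gK g'K; rewrite /schur.
rewrite (reindex T) /=; last first.
  exists (fun U => (U (g false), U (g true))) => [[i j] _ | U _].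
    by rewrite !ffunE !gK.
  by apply/ffunP => c; rewrite !ffunE /= -[in RHS](g'K c); case: (g' c).
apply: eq_bigr => p _.
rewrite (reindex g) /=; last by exists g' => c _; rewrite ?gK ?g'K.
by rewrite big_bool /= !ffunE !gK mulrC.
Qed.

Lemma schur_row1 (n : nat) : schur n row1 = \sum_(i < n) 'X_i.
Proof.
have cell_eq (c d : cell row1) : c = d.
  by case: c d => [c1 c2] [d1 d2]; move: c2 d2; rewrite (ord1 c1) (ord1 d1)
    => c2 d2; rewrite (ord1 c2) (ord1 d2).
pose c0 : cell row1 := existT _ ord0 ord0.
rewrite /schur (reindex (fun i => [ffun=> i])) /=; last first.
  exists (fun T => T c0) => [i _ | T _]; first by rewrite ffunE.
  by apply/ffunP => c; rewrite ffunE (cell_eq c c0).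
apply: eq_big => [i | i _].
  apply/forallP => c; apply/forallP => d.
  by rewrite (cell_eq c d) !ltnn !andbF.
rewrite (big_pred1 c0) ?ffunE // => c.
by rewrite /= (cell_eq c c0) eqxx.
Qed.

Lemma schur_row2 (n : nat) :
  schur n row2 = \sum_(p : 'I_n * 'I_n | (p.1 <= p.2)%N) 'X_(p.1) * 'X_(p.2).
Proof.
pose g (b : bool) : cell row2 := existT _ ord0 (if b then ord_max else ord0).
pose g' (c : cell row2) := (0 < cell_col c)%N.
have gK : cancel g g' by case.
have g'K : cancel g' g.
  case=> i; rewrite (ord1 i) /g /g' /cell_col => j /=.
  by congr existT; apply: val_inj; case: j => [[|[|]]].
rewrite (schur_two_cells n gK g'K); apply: eq_bigl => -[i j] /=.
apply/idP/idP => [ss | leij].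
  by have := forallP (forallP ss (g false)) (g true);
    rewrite !ffunE !gK => /andP[].
apply/forallP => c; apply/forallP => d; rewrite -(g'K c) -(g'K d) !ffunE !gK.
by case: (g' c) (g' d) => [] [] //=; rewrite andbT.
Qed.

Lemma schur_col2 (n : nat) :
  schur n col2 = \sum_(p : 'I_n * 'I_n | (p.1 < p.2)%N) 'X_(p.1) * 'X_(p.2).
Proof.
pose g (b : bool) : cell col2 :=
  if b then existT _ ord_max ord0 else existT _ ord0 ord0.
pose g' (c : cell col2) := (0 < cell_row c)%N.
have gK : cancel g g' by case.
have g'K : cancel g' g.
  case=> [[[|[|//]] lti]] j; rewrite /g /g' /cell_row /=.
    by rewrite (bool_irrelevance lti (ltn0Sn 1)) in j *; rewrite (ord1 j).
  by rewrite (bool_irrelevance lti (ltnSn 1)) in j *; rewrite (ord1 j).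
rewrite (schur_two_cells n gK g'K); apply: eq_bigl => -[i j] /=.
apply/idP/idP => [ss | leij].
  by have := forallP (forallP ss (g false)) (g true);
    rewrite !ffunE !gK => /andP[].
apply/forallP => c; apply/forallP => d; rewrite -(g'K c) -(g'K d) !ffunE !gK.
by case: (g' c) (g' d) => [] [].
Qed.

(** Pieri's rule in its smallest instance: s_(1) s_(1) = s_(2) + s_(1,1). It makes
    the expansion selected by [lr_expansion row1 row1] a genuine one rather than
    the default zero family. *)
Lemma schur_expansion_row1 :
  exists f, schur_expansion row1 row1 f.
Proof.
pose f : {fsfun part -> nat with 0%N} :=
  [fsfun la in [fset row2; col2]%fset => 1%N].
exists f => n; have -> : finsupp f = [fset row2; col2]%fset.
  by apply/fsetP => la; rewrite mem_finsupp fsfunE; case: ifP.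
rewrite big_fsetU1 ?inE //= big_seq_fset1 !fsfunE !inE !eqxx orbT !mulr1n.
rewrite schur_row1 schur_row2 schur_col2 big_distrlr /= pair_big /=.
rewrite (bigID (fun p : 'I_n * 'I_n => (p.1 <= p.2)%N)) /=; congr +%R.
rewrite (reindex (fun p : 'I_n * 'I_n => (p.2, p.1))) /=; last first.
  by exists (fun p => (p.2, p.1)) => -[].
by apply: eq_big => [p | p _]; rewrite ?ltnNge // mulrC.
Qed.

(** In one variable, in degree 2, (2) is the only partition whose Schur
    polynomial survives, and the left-hand side s_(1) s_(1) is nonzero. *)
Lemma lr_coef_row1_row2 : lr_coef row1 row1 row2 != 0%N.
Proof.
rewrite /lr_coef /lr_expansion.
have [f exp_f] := schur_expansion_row1.
case: xgetP => [{exp_f}f _ /= exp_f | /(_ f)//].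
apply/eqP => f0; have := schur_expansion_graded 1 2 exp_f.
rewrite big1 => [|mu _]; last first.
  have [/esym mu2|] := eqVneq; last by rewrite mul0n.
  have [->|] := posnP (ssyt_count 1 mu); first by rewrite mul0n muln0.
  by move=> /ssyt_count1_gt0/(part_row2 mu2) ->; rewrite f0 !muln0.
by apply/eqP; rewrite mul1n -lt0n muln_gt0 ssyt_count_gt0.
Qed.

(** * Newell-Littlewood numbers *)

Lemma newell_littlewood_odd (mu nu la : part) :
  odd (sumn mu + sumn nu + sumn la) -> newell_littlewood mu nu la = 0%N.
Proof.
move=> odd_sum; apply: fsbig1 => -[[al be] ga] _ /=.
apply/eqP; apply: contraLR odd_sum; rewrite !muln_eq0 !negb_or.
move=> /andP[/andP[/lr_coef_graded-> /lr_coef_graded->] /lr_coef_graded->].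
by rewrite !oddD; do 3!case: (odd _).
Qed.

Lemma newell_littlewood_row2 : newell_littlewood row2 row2 row2 != 0%N.
Proof.
(* Restricting to a singleton also shows that the support is finite, without
   which the sum would be 0 by convention. *)
rewrite /newell_littlewood -(fsbig_widen [set (row1, row1, row1)]%classic) //=.
  by rewrite fsbig_set1 /= !muln_eq0 !(negPf lr_coef_row1_row2).
move=> [[al be] ga] [_ neq1] /=; apply: contrapT => /eqP.
rewrite !muln_eq0 !negb_or => /andP[/andP[]].
move=> /lr_coef_graded/= ab /lr_coef_graded/= ac /lr_coef_graded/= bc.
have a1 : sumn al = 1%N by lia.
have b1 : sumn be = 1%N by lia.
have c1 : sumn ga = 1%N by lia.
by apply: neq1; rewrite (part_sumn1 a1) (part_sumn1 b1) (part_sumn1 c1).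
Qed.

Lemma sumn_scale_row1 (k : nat) : sumn (scale_part k row1) = k.
Proof. by rewrite /= muln1; case: k => [|k] //=; rewrite addn0. Qed.

(** * Failure of polynomiality *)

Lemma poly_odd_roots_eq0 (R : numDomainType) (f : {poly R}) :
  (forall k : nat, odd k -> f.[k%:R] = 0) -> f = 0.
Proof.
move=> f0; apply/eqP; apply: contraT => f_neq0.
pose rs : seq R := [seq (i.*2.+1)%:R | i <- iota 0 (size f)].
have : (size rs < size f)%N.
  apply: max_poly_roots => //.
    by apply/allP => _ /mapP[i _ ->]; rewrite rootE f0 //= odd_double.
  rewrite map_inj_uniq ?iota_uniq // => i j /eqP.
  by rewrite eqr_nat eqSS => /eqP/double_inj.
by rewrite size_map size_iota ltnn.
Qed.

Theorem theorem5p25 (R : realType) :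
  exists la mu nu : part,
    ~ exists f : {poly R}, forall k : nat, (1 <= k)%N ->
        f.[k%:R] =
          (newell_littlewood (scale_part k mu) (scale_part k nu)
             (scale_part k la))%:R.
Proof.
exists row1, row1, row1 => -[f fE].
have f_eq0 : f = 0.
  apply: poly_odd_roots_eq0 => k odd_k; rewrite fE ?odd_gt0 //.
  by rewrite newell_littlewood_odd // !sumn_scale_row1 !oddD odd_k.
have scale2 : scale_part 2 row1 = row2 by apply: val_inj.
have /eqP := fE 2%N isT; rewrite scale2 f_eq0 horner0 eq_sym pnatr_eq0.
by apply/negP/newell_littlewood_row2.
Qed.
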